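(* For every integer $n\ge 1$ we have $p(n,1)=1$, and for all integers $n,k\ge 2$, $$p(n,k)=\sum_{m=1}^{\lfloor n/k\rfloor}\sum_{\nu=1}^{k-1}p(n-km,\nu).$$ Consequently, for $n\ge 2$, $$p(n)=1+\sum_{k=2}^{n}\sum_{m=1}^{\lfloor n/k\rfloor}\sum_{\nu=1}^{k-1}p(n-km,\nu).$$
   Context: A partition of a nonnegative integer $n$ is a multiset of positive integers (parts) summing to $n$. $p(n)$ is the number of partitions of $n$ and $p(n,k)$ the number of partitions of $n$ into exactly $k$ parts. Conventions: $p(0)=1$ and $p(0,1)=1$ (the empty partition of $0$ is counted as the unique partition of $0$); otherwise $p(n,k)=0$ whenever $n<0$, $k<1$, or $k>n$ (in particular $p(0,\nu)=0$ for $\nu\ge 2$). *)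

(* Defs.v *)
From mathcomp Require Import all_boot finmap multiset.
From mathcomp Require Import boolp classical_sets functions cardinality.

Set Implicit Arguments.
Unset Strict Implicit.
Unset Printing Implicit Defensive.

Local Open Scope classical_set_scope.
Local Open Scope mset_scope.
Local Open Scope nat_scope.

Definition is_partition (n : nat) (A : {mset nat}) : Prop :=
  (forall x : nat, x \in A -> 0 < x) /\ \sum_(x <- A) x = n.

Definition partitions (n : nat) : set {mset nat} := [set A | is_partition n A].

(* [size A] is the size of the list of elements of [A] counted with
   multiplicity, that is, the number of parts. *)
Definition partitions_into (n k : nat) : set {mset nat} :=
  partitions n `&` [set A | size A = k].

(* [fset_set] returns the empty set on infinite sets; this default is never
   reached below, by [finite_partitions] and [finite_partitions_into]. *)
Lemma finite_partitions n : finite_set (partitions n).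
Proof.
pose f (t : n.-tuple 'I_n.+1) : {mset nat} :=
  seq_mset [seq x <- map val t | 0 < x].
apply: (@sub_finite_set _ _ [set f t | t in [set: n.-tuple 'I_n.+1]]); last first.
  exact/finite_image/finite_finset.
move=> A [Apos Asum].
pose s : seq nat := A.
have s_pos x : x \in s -> 0 < x by apply: Apos.
have s_sum : sumn s = n by rewrite sumnE.
have s_le x : x \in s -> x <= n.
  rewrite -s_sum => xs; rewrite sumnE (big_rem x xs) /=; exact: leq_addr.
have s_size : size s <= n.
  rewrite -s_sum; elim: (s) s_pos => //= x r IHr pos.
  rewrite -add1n leq_add ?pos ?mem_head // IHr // => y yr.
  by apply: pos; rewrite inE yr orbT.
pose u : seq 'I_n.+1 := map inord s ++ nseq (n - size s) ord0.
have u_size : size u == n.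
  by rewrite size_cat size_map size_nseq subnKC.
exists (Tuple u_size) => //.
rewrite /f /= -[RHS]seq_mset_id; congr seq_mset.
rewrite map_cat filter_cat map_nseq filter_nseq /= cats0 -map_comp.
have -> : map (val \o inord (n' := n)) s = s.
  by rewrite -[RHS]map_id; apply/eq_in_map => x /s_le xn /=; rewrite inordK.
by apply/all_filterP/allP.
Qed.

Lemma finite_partitions_into n k : finite_set (partitions_into n k).
Proof. by apply: sub_finite_set (finite_partitions n) => A []. Qed.

Definition p (n : nat) : nat := #|` fset_set (partitions n)|.

(* The case [n = 0] is a convention: the empty partition of 0, although it
   has no part, is counted by [pk 0 1], and [pk 0 k = 0] for [k != 1]. *)
Definition pk (n k : nat) : nat :=
  if n == 0 then nat_of_bool (k == 1)
  else #|` fset_set (partitions_into n k)|.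

(* Main.v *)
(** Subtracting 1 from every part, and discarding the parts that become 0, is a
    bijection from the partitions of [n] into exactly [k] parts onto the
    partitions of [n - k] into at most [k] parts.  Hence, with [q n k] the number
    of partitions of [n] into exactly [k] parts,
    [q n k = q (n - k) k + \sum_(nu < k) q (n - k) nu] for [k <= n], and iterating
    on the first summand gives the recurrence. *)
Require Import Defs.
From mathcomp Require Import all_boot.
From mathcomp Require Import finmap multiset.
From mathcomp Require Import classical_sets cardinality.

Set Implicit Arguments.
Unset Strict Implicit.
Unset Printing Implicit Defensive.

Local Open Scope mset_scope.
Local Open Scope nat_scope.

(** Counts without the convention that [pk] makes at [n = 0]: here the empty partition has 0 parts,
    so the recurrence also holds when [n - k = 0]. *)
Definition npart (n k : nat) : nat := #|` fset_set (partitions_into n k)|.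

(** The bound is strict to match sums over [i < k]; at most [k] parts is expressed with [k.+1]. *)
Definition partitions_upto (n k : nat) : set {mset nat} :=
  (partitions n `&` [set A : {mset nat} | size A < k])%classic.

Lemma finite_partitions_upto n k : finite_set (partitions_upto n k).
Proof. by apply: sub_finite_set (finite_partitions n) => A []. Qed.

(** Double counting of the pairs [(i, x)] with [f x = i]: each [x] occurs for exactly one index
    [i]. *)
Lemma card_fset_by_value (T : choiceType) (X : {fset T}) (f : T -> nat) k :
  (forall x, x \in X -> f x < k) ->
  #|` X| = \sum_(i < k) #|` [fset x in X | f x == i]%fset|.
Proof.
move=> fk; under eq_bigr => i _ do rewrite card_fset_sum1 -big_fset_condE big_mkcond.
rewrite exchange_big card_fset_sum1 !big_seq.
apply: eq_bigr => x /fk fx; rewrite -big_mkcond /=.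
by rewrite (big_pred1 (Ordinal fx)) // => i; rewrite eq_sym.
Qed.

Lemma card_partitions_upto n k :
  #|` fset_set (partitions_upto n k)| = \sum_(i < k) npart n i.
Proof.
rewrite (@card_fset_by_value _ _ (fun A : {mset nat} => size A) k); last first.
  move=> A; rewrite in_fset_set; last exact: finite_partitions_upto.
  by move=> /set_mem[].
apply: eq_bigr => i _; congr (#|` _|); apply/fsetP => A.
rewrite !inE !in_fset_set; [|exact: finite_partitions_upto|exact: finite_partitions_into].
apply/andP/idP => [[/set_mem [An _] /eqP Ai]|/set_mem [An Ai]]; first exact/mem_set.
by split; [apply/mem_set; split; rewrite //= Ai | apply/eqP].
Qed.

(** In the Ferrers diagram with the parts as rows, a full column of [k] cells is put in front; the
    appended 1s are the rows that were empty. This makes sense for [size s <= k]. *)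
Definition add_columns (k : nat) (s : seq nat) : seq nat :=
  map S s ++ nseq (k - size s) 1.

Definition drop_column (s : seq nat) : seq nat :=
  [seq x <- map predn s | 0 < x].

Lemma add_columnsK k s : all (leq 1) s -> drop_column (add_columns k s) = s.
Proof.
move=> /all_filterP s_pos.
rewrite /drop_column map_cat filter_cat map_nseq filter_nseq cats0.
by rewrite -map_comp map_id.
Qed.

(** Parts above 1 survive the subtraction and are restored by [S]; parts equal to 1 vanish and are
    restored by the padding. The 1s end up last, hence equality only up to permutation. *)
Lemma drop_columnK s :
  all (leq 1) s -> perm_eq (add_columns (size s) (drop_column s)) s.
Proof.
move=> s_pos; rewrite perm_sym -(perm_filterC (fun x => 1 < x)) perm_sym.
have E : map S (drop_column s) = [seq x <- s | 1 < x].
  rewrite /drop_column filter_map -map_comp.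
  rewrite (@eq_filter _ _ (fun x => 1 < x)) => [|[|[]]//].
  rewrite -[RHS]map_id; apply/eq_in_map => x.
  by rewrite mem_filter; case: x.
have d_size : size (drop_column s) = size [seq x <- s | 1 < x] by rewrite -E size_map.
rewrite /add_columns E d_size perm_cat2l.
have -> : size s - size [seq x <- s | 1 < x] = size [seq x <- s | ~~ (1 < x)].
  by rewrite !size_filter -(count_predC (fun x => 1 < x) s) addKn.
suff /all_pred1P <- : all (pred1 1) [seq x <- s | ~~ (1 < x)] by [].
apply/allP => x; rewrite mem_filter => /andP[x1 /(allP s_pos)].
by case: x x1 => [|[]].
Qed.

Lemma sumn_add_columns k s : size s <= k -> sumn (add_columns k s) = sumn s + k.
Proof.
move=> sk; rewrite sumn_cat sumn_nseq mul1n.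
have -> : sumn (map S s) = sumn s + size s.
  by elim: s {sk} => //= x s ->; rewrite addSn addnS addnA.
by rewrite -addnA subnKC.
Qed.

Lemma partitionP n (A : {mset nat}) :
  is_partition n A <-> all (leq 1) A /\ sumn A = n.
Proof.
rewrite sumnE; split=> -[A_pos A_sum]; split=> //; first exact/allP.
exact/allP.
Qed.

Lemma is_partition_seq_mset n (s : seq nat) :
  all (leq 1) s -> sumn s = n -> is_partition n (seq_mset s).
Proof.
move=> s_pos s_sum; apply/partitionP; have e := perm_eq_seq_mset s.
by rewrite (perm_all _ e) (perm_sumn e).
Qed.

Lemma npart_upto n k : k <= n ->
  npart n k = #|` fset_set (partitions_upto (n - k) k.+1)|.
Proof.
move=> kn; pose f (B : {mset nat}) := seq_mset (add_columns k B).
have finU := finite_partitions_upto (n - k) k.+1.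
rewrite /npart; have -> : partitions_into n k = (f @` partitions_upto (n - k) k.+1)%classic.
  apply/seteqP; split=> [A [/partitionP[A_pos A_sum] Ak]|_ [B [/partitionP[B_pos B_sum] Bk] <-]].
    have pA := drop_columnK A_pos; rewrite Ak in pA.
    have d_pos : all (leq 1) (drop_column A) by exact: filter_all.
    have d_size : size (drop_column A) <= k.
      by rewrite -Ak -(size_map predn A) size_filter count_size.
    have pd := perm_eq_seq_mset (drop_column A).
    (* Surjectivity: the preimage of [A] is [A] with its first column removed. *)
    exists (seq_mset (drop_column A)); last first.
      rewrite /f -[RHS]seq_mset_id; apply/eq_seq_msetP/(perm_trans _ pA).
      by rewrite /add_columns (perm_size pd) perm_cat2r perm_map.
    split; last by rewrite /= (perm_size pd).
    apply: is_partition_seq_mset => //.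
    by rewrite -A_sum -(perm_sumn pA) sumn_add_columns // addnK.
  split; last first.
    by rewrite /= (perm_size (perm_eq_seq_mset _)) size_cat size_map size_nseq subnKC.
  apply: is_partition_seq_mset; last by rewrite sumn_add_columns // B_sum subnK.
  rewrite all_cat all_map; apply/andP; split; first by apply/allP.
  by apply/allP => x /nseqP[->].
(* It remains to see that [f] is injective: [drop_column] inverts [add_columns] and respects
   permutations, so it descends to multisets. *)
rewrite fset_set_image // card_in_imfset //= => B C.
rewrite !in_fset_set // => /set_mem[/partitionP[B_pos _] _] /set_mem[/partitionP[C_pos _] _].
move=> /eq_seq_msetP e; rewrite -[B]seq_mset_id -[C]seq_mset_id; apply/eq_seq_msetP.
rewrite -(add_columnsK k B_pos) -(add_columnsK k C_pos).
exact/perm_filter/perm_map.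
Qed.

Lemma npart_rec n k : k <= n ->
  npart n k = npart (n - k) k + \sum_(i < k) npart (n - k) i.
Proof.
by move=> kn; rewrite npart_upto // card_partitions_upto big_ord_recr addnC.
Qed.

Lemma size_partition n (A : {mset nat}) : is_partition n A -> size A <= n.
Proof.
case/partitionP => + <-; elim: (A : seq nat) => //= x s IHs /andP[x_pos s_pos].
by rewrite -add1n leq_add ?IHs.
Qed.

Lemma npart_gt n k : n < k -> npart n k = 0.
Proof.
move=> nk; apply/eqP; rewrite cardfs_eq0; apply/eqP/fsetP => A.
rewrite in_fset_set; last exact: finite_partitions_into.
apply/negbTE/negP => /set_mem[/size_partition An Ak].
by move: nk; rewrite -Ak ltnNge An.
Qed.

Lemma npart0 n : 0 < n -> npart n 0 = 0.
Proof.
move=> n_gt0; apply/eqP; rewrite cardfs_eq0; apply/eqP/fsetP => A.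
rewrite in_fset_set; last exact: finite_partitions_into.
apply/negbTE/negP => /set_mem[/partitionP[_ +] /size0nil A0].
by rewrite A0 /= => n0; rewrite -n0 in n_gt0.
Qed.

Lemma npart00 : npart 0 0 = 1.
Proof.
apply/eqP/cardfs1P; exists mset0; apply/fsetP => A.
rewrite in_fset_set ?in_fset1; last exact: finite_partitions_into.
apply/idP/eqP => [/set_mem[_ /size0nil A0]|->].
  by rewrite -[A]seq_mset_id A0; apply/msetP => x; rewrite mset_seqE mset0E.
apply/mem_set; have -> : mset0 = seq_mset [::] :> {mset nat}.
  by apply/msetP => x; rewrite mset_seqE mset0E.
split; first exact: is_partition_seq_mset.
by rewrite /= (perm_size (perm_eq_seq_mset _)).
Qed.

Lemma pkE n k : 0 < n -> pk n k = npart n k.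
Proof. by rewrite /pk; case: n. Qed.

(* The conventions for [n = 0] replace the partition of 0 into 0 parts by one
   into 1 part, which does not affect the sum when [1 < k]. *)
Lemma sum_pk n k : 1 < k ->
  \sum_(1 <= nu < k) pk n nu = \sum_(i < k) npart n i.
Proof.
move=> k_gt1; rewrite -(big_mkord xpredT) [RHS]big_ltn 1?ltnW //.
have [->|n_gt0] := posnP n; last first.
  by rewrite npart0 //; apply: eq_bigr => i _; rewrite pkE.
rewrite npart00 big_ltn // !big_nat !big1 // => i /andP[i_gt _].
  by rewrite npart_gt.
by rewrite /pk eqxx gtn_eqF.
Qed.

Lemma npart_sum n k : 0 < k ->
  npart n k =
  \sum_(1 <= m < (n %/ k).+1) \sum_(i < k) npart (n - k * m) i.
Proof.
(* Induction on how often [k] can be subtracted from [n]. The sum in [npart_rec] is the term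
   [m = 1], and the induction hypothesis at [n - k] gives the others after shifting [m]; once
   [n < k] both sides are 0. *)
move=> k_gt0; have [d] := ubnP (n %/ k); elim: d n => // d IHd n nd.
have [nk|kn] := ltnP n k; first by rewrite npart_gt // divn_small // big_geq.
have En : n %/ k = ((n - k) %/ k).+1 by rewrite -{1}(subnK kn) divnDr // divnn k_gt0 addn1.
rewrite npart_rec // IHd; last by rewrite -En.
rewrite En [RHS]big_ltn // muln1 addnC [in RHS]big_add1; congr addn.
by apply: eq_bigr => m _; rewrite mulnS subnDA.
Qed.

Lemma pk_sum n k : 1 <= n -> 2 <= k ->
  pk n k = \sum_(1 <= m < (n %/ k).+1) \sum_(1 <= nu < k) pk (n - k * m) nu.
Proof.
move=> n_gt0 k_gt1; rewrite pkE // npart_sum 1?ltnW //.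
by apply: eq_bigr => m _; rewrite sum_pk.
Qed.

Lemma npart1 n : 0 < n -> npart n 1 = 1.
Proof.
(* For [k = 1] the recurrence reads [npart n.+1 1 = npart n 1 + npart n 0]: the value 1 comes from
   [npart 0 0] at the first step and from [npart n 1] afterwards. *)
elim: n => // -[_ _|n IHn _]; rewrite npart_rec // subn1 big_ord1 /=.
  by rewrite npart_gt // npart00.
by rewrite IHn // npart0.
Qed.

Lemma p_sum n : p n = \sum_(k < n.+1) npart n k.
Proof.
rewrite -card_partitions_upto; congr (#|` fset_set _|); apply/seteqP; split=> [A An|A []//].
by split=> //; rewrite /= ltnS size_partition.
Qed.

Theorem theorem2 :
  (forall n : nat, 1 <= n -> pk n 1 = 1)
  /\ (forall n k : nat, 2 <= n -> 2 <= k ->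
        pk n k = \sum_(1 <= m < (n %/ k).+1) \sum_(1 <= nu < k) pk (n - k * m) nu)
  /\ (forall n : nat, 2 <= n ->
        p n = 1 + \sum_(2 <= k < n.+1) \sum_(1 <= m < (n %/ k).+1)
                    \sum_(1 <= nu < k) pk (n - k * m) nu).
Proof.
split; first by move=> n n_gt0; rewrite pkE // npart1.
split=> [n k n_gt1 k_gt1|n n_gt1]; first by rewrite pk_sum // ltnW.
have n_gt0 := ltnW n_gt1.
(* The term [k = 0] vanishes and the term [k = 1] is the leading 1. *)
rewrite p_sum -(big_mkord xpredT) big_ltn // npart0 // add0n big_ltn // npart1 //.
congr addn.
by apply: eq_big_nat => k /andP[k_gt1 _]; rewrite -pkE // pk_sum.
Qed.
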